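(* Let $n\ge2$. For any $\alpha\in[0,180^\circ]$ there exists a set $H\subset\mathbb{R}^n$ such that $H$ does not contain the angle $\alpha$, and $H$ has full Lebesgue outer measure; that is, its complement $\mathbb{R}^n\setminus H$ does not contain any Lebesgue measurable set of positive measure. In particular, the Hausdorff dimension of $H$ is $n$.
   Context: A set $A\subset\mathbb{R}^n$ contains the angle $\alpha\in[0,180^\circ]$ if there exist distinct points $x,y,z\in A$ such that the angle between the vectors $y-x$ and $z-x$ is $\alpha$. *)

(* Defs.v *)
From HB Require Import structures.
From mathcomp Require Import all_boot all_order all_algebra.
From mathcomp Require Import all_classical all_reals all_analysis.

Set Implicit Arguments.
Unset Strict Implicit.
Unset Printing Implicit Defensive.
Import Order.TTheory GRing.Theory Num.Theory.

Local Open Scope classical_set_scope.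
Local Open Scope ring_scope.

Section Euclidean.
Context {R : realType} {n : nat}.
Implicit Types (x y z u v : 'rV[R]_n) (A : set 'rV[R]_n).

Definition dotv u v : R := \sum_(i < n) u 0 i * v 0 i.

(* The library norm `|u| on 'rV[R]_n is the sup norm, not this one. *)
Definition enorm u : R := Num.sqrt (dotv u u).

(* In radians; only meaningful for nonzero u and v. *)
Definition angle u v : R := acos (dotv u v / (enorm u * enorm v)).

Definition contains_angle A (alpha : R) : Prop :=
  exists x y z, [/\ A x, A y & A z] /\ [/\ x != y, x != z & y != z] /\
    angle (y - x) (z - x) = alpha.

End Euclidean.

Section Lebesgue.
Context {R : realType} {n : nat}.
Implicit Types (a b : 'rV[R]_n) (A H : set 'rV[R]_n).
Local Open Scope ereal_scope.

Definition box a b : set 'rV[R]_n :=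
  [set x | forall i, (a 0 i < x 0 i <= b 0 i)%R].

Definition box_volume a b : R := (\prod_(i < n) (b 0 i - a 0 i))%R.

Definition box_cover A : set ((nat -> 'rV[R]_n) * (nat -> 'rV[R]_n)) :=
  [set ab : (nat -> 'rV[R]_n) * (nat -> 'rV[R]_n) |
     (forall k i, (ab.1 k 0 i <= ab.2 k 0 i)%R) /\
     A `<=` \bigcup_k box (ab.1 k) (ab.2 k)].

Definition lebesgue_outer A : \bar R :=
  ereal_inf [set \sum_(k <oo) (box_volume (ab.1 k) (ab.2 k))%:E
            | ab in box_cover A].

(* On these sets, lebesgue_outer is the (complete) Lebesgue measure. *)
Definition lebesgue_measurable A : Prop := lebesgue_outer.-caratheodory A.

Definition full_outer_measure H : Prop :=
  ~ exists A, [/\ lebesgue_measurable A, A `<=` ~` H & 0 < lebesgue_outer A].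

End Lebesgue.

Section Hausdorff.
Context {R : realType} {n : nat}.
Implicit Types (A U : set 'rV[R]_n) (s delta : R).
Local Open Scope ereal_scope.

Definition diam U : \bar R :=
  ereal_sup [set (enorm (p.1 - p.2))%:E | p in U `*` U].

(* diam U ^ s, with 0 ^ 0 = 1 and the empty set contributing 0 for every s. *)
Definition diam_pow s U : \bar R :=
  if U == set0 then 0 else diam U `^ s.

Definition delta_cover delta A : set (nat -> set 'rV[R]_n) :=
  [set U | (forall k, diam (U k) <= delta%:E) /\ A `<=` \bigcup_k U k].

Definition hausdorff_pre s delta A : \bar R :=
  ereal_inf [set \sum_(k <oo) diam_pow s (U k) | U in delta_cover delta A].

Definition hausdorff_measure s A : \bar R :=
  ereal_sup [set hausdorff_pre s delta A | delta in [set d : R | (0 < d)%R]].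

Definition hausdorff_dim A : \bar R :=
  ereal_inf [set s%:E | s in [set s | (0 <= s)%R /\ hausdorff_measure s A = 0]].

End Hausdorff.

(* Main.v *)
Require Import Defs.
From mathcomp Require Import all_boot all_order all_algebra.
From mathcomp Require Import all_classical all_reals all_analysis.
From mathcomp Require Import measurable_realfun ring lra wochoice.
Set Implicit Arguments.
Unset Strict Implicit.
Unset Printing Implicit Defensive.
Import Order.TTheory GRing.Theory Num.Theory.
Local Open Scope classical_set_scope.

(** Following the classical transfinite construction, [H] is chosen so that it
    meets every set [Q \ (B_0 u B_1 u ...)] where [Q] is a box and the boxes
    [B_k] have total volume less than that of [Q]. There are continuum many such
    data, and they are treated in a well-order whose initial segments are small.
    At each step the new point must avoid the zero sets of a small family of
    polynomials, namely those expressing that the point forms the angle [alpha]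
    or [pi - alpha] with two earlier points. Its coordinates are picked one at a
    time: by Fubini the admissible values of the next coordinate have positive
    measure, each polynomial forbids finitely many of them, and a set [E] of
    positive measure is never covered by a small family of finite sets because
    every real is of the form [(e' - e) / q] with [e, e'] in [E] and [q]
    rational. If a measurable [A] of positive measure missed [H], then [Q \ A]
    would be covered by boxes of total volume less than that of [Q] for some
    large cube [Q]; likewise a cover of [H] witnessing dimension less than [n]
    would give boxes of total volume less than [1] covering [H]. *)

(** * Small sets and transfinite selection *)

(* [B] is parametrized by finite sequences of elements of [A] and a natural
   number. Allowing sequences makes the relation transitive without cardinal
   arithmetic; a set is called small below if it does not dominate the continuum. *)
Definition dominated {U V : eqType} (B : set V) (A : set U) : Prop :=
  exists phi : nat -> seq U -> V, forall v, B v ->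
    exists k l, (forall u, u \in l -> A u) /\ phi k l = v.

(** Every entry of a sequence over [B] has its own code over [A]. The sequences of these codes are
    concatenated, and their shape, their indices and [k0] are packed into one natural number, from
    which [reshape] separates them again. *)
Lemma dominated_trans (U V W : eqType) (A : set U) (B : set V) (D : set W) :
  dominated D B -> dominated B A -> dominated D A.
Proof.
move=> [psi psiP] [phi phiP].
exists (fun k l =>
  if (unpickle k : option (nat * seq nat * seq nat)) is Some (k0, ks, sh)
  then psi k0 [seq phi p.1 p.2 | p <- zip ks (reshape sh l)] else psi 0 [::]).
move=> w /psiP[k0 [l [lB <-]]].
have [ks [ss [sz ssA <-]]] : exists ks ss, [/\ size ks = size ss,
    forall u, u \in flatten ss -> A u &
    [seq phi p.1 p.2 | p <- zip ks ss] = l].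
  elim: l lB => [_|v l IHl lB]; first by exists [::], [::].
  have /IHl[ks [ss [sz ssA <-]]] : forall u, u \in l -> B u.
    by move=> u ul; apply: lB; rewrite in_cons ul orbT.
  have /phiP[k [s [sA <-]]] : B v by apply: lB; rewrite mem_head.
  exists (k :: ks), (s :: ss); split => //=; first by rewrite sz.
  by move=> u; rewrite mem_cat => /orP[/sA|/ssA].
exists (pickle (k0, ks, shape ss)), (flatten ss); split => //.
by rewrite pickleK flattenK.
Qed.

Lemma dominated_sub (U V : eqType) (A A' : set U) (B B' : set V) :
  A' `<=` A -> B `<=` B' -> dominated B' A' -> dominated B A.
Proof.
move=> AA BB [phi phiP]; exists phi => v /BB/phiP[k [l [lA <-]]].
by exists k, l; split=> // u /lA/AA.
Qed.

Lemma dominated_image (U V : eqType) (v0 : V) (A : set U) (f : U -> V) :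
  dominated (f @` A) A.
Proof.
exists (fun _ l => if l is u :: _ then f u else v0) => _ [u Au <-].
by exists 0, [:: u]; split => // w; rewrite inE => /eqP->.
Qed.

Lemma dominated_setU1 (U : eqType) (A : set U) (u0 : U) :
  dominated (A `|` [set u0]) A.
Proof.
exists (fun _ l => head u0 l) => u [Au|->]; last by exists 0, [::].
by exists 0, [:: u]; split => // w; rewrite inE => /eqP->.
Qed.

Section WellOrder.
Variables (T : eqType) (le : rel T).
Hypothesis wo : well_order le.

Lemma well_order_min (S : set T) : S !=set0 ->
  exists2 m, S m & forall x, S x -> le m x.
Proof.
move=> [x Sx].
have [|m [[mS mmin] _]] := @wo (fun y => `[< S y >]).
  by exists x; rewrite unfold_in; apply/asboolP.
exists m; first by move: mS; rewrite unfold_in => /asboolP.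
by move=> y Sy; apply: mmin; rewrite unfold_in; apply/asboolP.
Qed.

Lemma well_order_anti x y : le x y -> le y x -> x = y.
Proof.
move=> xy yx.
have /= := @wo_chain_antisymmetric T le predT. 
move=> /(_ _ x y). apply => //; last by rewrite xy yx.
by move=> A _; apply: wo.
Qed.

Lemma well_order_total x y : le x y \/ le y x.
Proof.
have [|m [->|->] mmin] := @well_order_min [set x; y]; first by exists x; left.
- by left; apply: mmin; right.
- by right; apply: mmin; left.
Qed.

Lemma well_order_trans x y z : le x y -> le y z -> le x z.
Proof.
move=> xy yz.
have [|m] := @well_order_min [set t | t = x \/ t = y \/ t = z].
  by exists x; left.
move=> [->|[->|->]] mmin.
- by apply: mmin; right; right.
- by rewrite (@well_order_anti x y) //; apply: mmin; left.
- by rewrite -(@well_order_anti y z) //; apply: mmin; right; left.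
Qed.

Definition wo_lt x y := le x y /\ x <> y.

Lemma wo_lt_wf : well_founded wo_lt.
Proof.
move=> x; apply: contrapT => nx.
have [|m nm mmin] := @well_order_min [set y | ~ Acc wo_lt y]; first by exists x.
apply: nm; constructor => y [ym nym]; apply: contrapT => ny.
by apply: nym; apply: well_order_anti => //; apply: mmin.
Qed.

Lemma wo_lt_trans x y z : wo_lt x y -> wo_lt y z -> wo_lt x z.
Proof.
move=> [xy nxy] [yz nyz]; split; first exact: well_order_trans yz.
by move=> xz; apply: nxy; apply: well_order_anti; rewrite // xz.
Qed.

Lemma wo_lt_total x y : x <> y -> wo_lt x y \/ wo_lt y x.
Proof.
move=> nxy; have [xy|yx] := well_order_total x y; first by left.
by right; split=> // /esym.
Qed.

Lemma well_order_ltVeq x y : le x y -> wo_lt x y \/ x = y.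
Proof. by move=> xy; have [->|/eqP nxy] := eqVneq x y; [right|left]. Qed.

End WellOrder.

(* Initial segments of a Zermelo well-order of [T] need not be small; the
   points are therefore first ranked by an initial segment [D] all of whose
   proper initial segments are small while [D] itself is not. *)
Lemma small_segments_order (T : eqType) (x0 : T) :
  ~ dominated [set: T] (@set0 T) ->
  exists lt : T -> T -> Prop, [/\ well_founded lt,
    forall x y, x <> y -> lt x y \/ lt y x,
    forall x y z, lt x y -> lt y z -> lt x z &
    forall x, ~ dominated [set: T] [set y | lt y x]].
Proof.
move=> unc; have [le wo] := well_ordering_principle T.
pose D := [set d | ~ dominated [set: T] [set y | wo_lt le y d]].
have D0 : D !=set0.
  have [|m _ mmin] := @well_order_min _ _ wo [set: T]; first by exists x0.
  exists m; apply: contra_not unc; apply: dominated_sub => // y [ym].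
  by case; apply: (well_order_anti wo) => //; apply: mmin.
(* If [D] were small it would not be all of [T]; the elements before the least one outside [D] all
   lie in [D], so that element would have a small segment and belong to [D]. *)
have [phi phiP] : dominated [set: T] D.
  apply: contrapT => Dsmall.
  have [|m /= nDm mmin] := @well_order_min _ _ wo (~` D).
    apply: contrapT => DT; apply: Dsmall; exists (fun _ l => head x0 l) => y _.
    exists 0, [:: y]; split => // z _; apply: contrapT => nDz.
    by apply: DT; exists z.
  apply: nDm; apply: contra_not Dsmall; apply: dominated_sub => // y [ym nym].
  by apply: contrapT => nDy; apply: nym; apply: (well_order_anti wo ym (mmin _ nDy)).
(* The rank of [c] is an element of [D] that bounds all entries of some code of [c]. Ranks are
   compared first, and ties are broken by [le]. *)
have /choice[rk rkP] c : exists d, D d /\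
    exists k l, (forall u, u \in l -> le u d) /\ phi k l = c.
  have [k [l [lD <-]]] := phiP c I.
  have [d Dd ld] : exists2 d, D d & forall u, u \in l -> le u d.
    elim: l lD => [_|u l IHl lD]; first by have [d Dd] := D0; exists d.
    have [|d Dd ld] := IHl; first by move=> v vl; apply: lD; rewrite inE vl orbT.
    have [ud|du] := well_order_total wo u d.
      by exists d => // v; rewrite inE => /orP[/eqP->|/ld].
    exists u; first by apply: lD; rewrite mem_head.
    move=> v; rewrite inE => /orP[/eqP->|/ld vd].
      by have [] := well_order_total wo u u.
    exact: (well_order_trans wo vd du).
  by exists d; split => //; exists k, l.
exists (fun x y => wo_lt le (rk x) (rk y) \/ rk x = rk y /\ wo_lt le x y); split.
- suff wf d : forall x, rk x = d -> Acc (fun x y => wo_lt le (rk x) (rk y) \/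
      rk x = rk y /\ wo_lt le x y) x by move=> x; exact: wf erefl.
  elim/(well_founded_ind (wo_lt_wf wo)): d => d IHd.
  elim/(well_founded_ind (wo_lt_wf wo)) => x IHx rkx; constructor => y [yx|[yx]].
    by apply: IHd erefl; rewrite -rkx.
  by move=> /IHx; apply; rewrite yx.
- move=> x y nxy; have [xy|/eqP] := eqVneq (rk x) (rk y).
    by have [] := wo_lt_total wo nxy; [left|right]; right; rewrite xy.
  by move=> /(wo_lt_total wo)[]; [left|right]; left.
- move=> x y z [xy|[xy xy']] [yz|[yz yz']].
  + by left; apply: wo_lt_trans yz.
  + by left; rewrite -yz.
  + by left; rewrite xy.
  + by right; rewrite xy; split=> //; apply: wo_lt_trans yz'.
(* Points below [x] have rank at most [rk x], hence codes with entries up to [rk x]; were they too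
   many, the segment below [rk x] would not be small. *)
- move=> x; have [Dx _] := rkP x; apply: contra_not Dx => big.
  apply: (dominated_trans _ (dominated_setU1 _ (rk x))).
  apply: (dominated_trans big); exists phi => y /= yx.
  have [_ [k [l [ly <-]]]] := rkP y; exists k, l; split=> // u /ly uy.
  have /(well_order_ltVeq)[|] : le u (rk x); [|by left|by right].
  by case: yx => [[yx _]|[<-]] //; apply: well_order_trans yx.
Qed.

(** Well-founded recursion along an order with small segments: the points chosen before [t] are the
    image of a small set, so [ext] supplies the next one. The symmetries of [bad] let the last
    chosen of three points stand in third place. *)
Lemma transfinite_selection (T : eqType) (X : choiceType) (t0 : T)
    (ok : T -> X -> Prop) (bad : X -> X -> X -> Prop) :
  ~ dominated [set: T] (@set0 T) ->
  (forall a b c, bad a b c -> bad b a c) ->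
  (forall a b c, bad a b c -> bad a c b) ->
  (forall (P : set X) t, ~ dominated [set: T] P ->
    exists x, ok t x /\ forall a b, P a -> P b -> a <> b -> ~ bad a b x) ->
  exists H : set X, (forall t, exists2 x, H x & ok t x) /\
    forall x y z, H x -> H y -> H z -> x <> y -> x <> z -> y <> z -> ~ bad x y z.
Proof.
move=> unc bad12 bad23 ext; have [lt [ltwf ltT ltt small]] := small_segments_order t0 unc.
have [x0 _] : exists x : X, True.
  have [|x _] := ext set0 t0; last by exists x.
  by apply: contra_not unc => -[phi phiP]; exists (fun k _ => phi k [::]) => t _;
    have [k [[|u l] [l0 <-]]] := phiP t I; [exists k, [::] | case: (l0 u); rewrite mem_head].
(* Distinctness is asked of the values rather than of the indices, because the same point may be
   chosen twice. *)
pose F t (rec : forall s, lt s t -> X) : X := xget x0 [set x | ok t x /\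
  forall r s (rt : lt r t) (st : lt s t), rec r rt <> rec s st ->
    ~ bad (rec r rt) (rec s st) x].
pose f := Fix ltwf (fun=> X) F.
have fE t : f t = F t (fun s _ => f s).
  rewrite /f Fix_eq // => {}t g h gh; congr (F t _).
  by apply: functional_extensionality_dep => s; apply: funext => st.
have fP t : ok t (f t) /\ forall r s, lt r t -> lt s t -> f r <> f s -> ~ bad (f r) (f s) (f t).
  have [x [okx badx]] : exists x, ok t x /\ forall a b, (f @` [set s | lt s t]) a ->
      (f @` [set s | lt s t]) b -> a <> b -> ~ bad a b x.
    apply: ext; apply: contra_not (small t) => big.
    exact: dominated_trans big (dominated_image x0 _ _).
  rewrite [f t]fE /F; case: xgetP => [y _ [oky bady]|/(_ x) []].
    by split=> // r s rt st; apply: bady.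
  by split=> // r s rt st; apply: badx; [exists r|exists s].
exists (range f); split=> [t|x y z]; first by exists (f t) => //; apply: (fP t).1.
(* With [s] before [r], the last of the three indices is [r] or [t]; in the first case [bad] is
   permuted to put [f r] last. *)
have max3 r s t : f r <> f s -> f r <> f t -> f s <> f t -> lt s r -> ~ bad (f r) (f s) (f t).
  move=> rs rt st sr B.
  have [ltrt|lttr] := ltT r t (contra_not (@congr1 _ _ f r t) rt).
    by apply: (fP t).2 B => //; apply: ltt ltrt.
  by apply: (fP r).2 (bad23 _ _ _ (bad12 _ _ _ B)).
move=> [r _ <-] [s _ <-] [t _ <-] xy xz yz.
have [|] := ltT r s (contra_not (@congr1 _ _ f r s) xy); last exact: max3.
by move=> rs /bad12; apply: max3 => //; apply/nesym.
Qed.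

Local Open Scope ring_scope.

(** * Coding by reals *)

Section Continuum.
Context {R : realType}.

(** Only the digits 0 and 1 are used in base 3: all digits after place [k] contribute at most half
    of [3^-k], so the first difference between two bit sequences decides the order of their sums. *)
Let ternary_sum (b : nat -> bool) N : R := \sum_(k < N) (b k)%:R * 3^-1 ^+ k.

Let ternary (b : nat -> bool) : R := sup (range (ternary_sum b)).

Let pow3_gt0 k : 0 < 3^-1 ^+ k :> R.
Proof. by rewrite exprn_gt0 // invr_gt0. Qed.

Let ternary_sumS b N : ternary_sum b N.+1 = ternary_sum b N + (b N)%:R * 3^-1 ^+ N.
Proof. by rewrite /ternary_sum big_ord_recr. Qed.

Let ternary_sum_le b K m :
  ternary_sum b (K + m) <= ternary_sum b K + 3 / 2 * 3^-1 ^+ K - 3 / 2 * 3^-1 ^+ (K + m).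
Proof.
elim: m => [|m IHm]; first by rewrite addn0; lra.
rewrite addnS ternary_sumS exprS.
have := pow3_gt0 (K + m); case: (b _) => /=; lra.
Qed.

Let ternary_sum_homo b K m : ternary_sum b K <= ternary_sum b (K + m).
Proof.
elim: m => [|m IHm]; first by rewrite addn0.
by rewrite addnS ternary_sumS (le_trans IHm)// lerDl mulr_ge0// ltW.
Qed.

Let ternary_sum_ub b K : ubound (range (ternary_sum b)) (ternary_sum b K + 3 / 2 * 3^-1 ^+ K).
Proof.
move=> _ [N _ <-]; have := ternary_sum_le b K N; have := pow3_gt0 (K + N).
by have := ternary_sum_homo b N K; rewrite addnC; lra.
Qed.

Let ternary_lt b b' k : (forall j, (j < k)%N -> b j = b' j) -> b k = false -> b' k ->
  ternary b < ternary b'.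
Proof.
move=> bb' bk b'k.
have E : ternary_sum b k = ternary_sum b' k.
  by apply: eq_bigr => i _; rewrite bb'.
have : ternary b <= ternary_sum b k.+1 + 3 / 2 * 3^-1 ^+ k.+1.
  by apply: ge_sup; [exists (ternary_sum b 0), 0%N|exact: ternary_sum_ub].
have : ternary_sum b' k.+1 <= ternary b'.
  apply: ub_le_sup; last by exists k.+1.
  by exists (ternary_sum b' 0 + 3 / 2 * 3^-1 ^+ 0); exact: ternary_sum_ub.
by rewrite !ternary_sumS bk b'k E exprS /=; have := pow3_gt0 k; lra.
Qed.

Let ternary_inj : injective ternary.
Proof.
move=> b b' bb'; apply: contrapT => /eqP nbb'.
have ex : exists k, b k != b' k.
  apply: contrapT => nex; move/eqP: nbb'; apply; apply: funext => k.
  by apply/eqP; apply: contrapT => /negP nk; apply: nex; exists k.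
case: (ex_minnP ex) => k bk kmin.
have agree j : (j < k)%N -> b j = b' j.
  by move=> jk; apply/eqP; apply: contraTT jk; rewrite -leqNgt => /kmin.
case: (boolP (b k)) bk => bk; case: (boolP (b' k)) => // b'k _.
- have : ternary b' < ternary b by apply: (@ternary_lt _ _ k); [move=> j /agree|exact/negbTE|].
  by rewrite bb' ltxx.
- have : ternary b < ternary b' by apply: (@ternary_lt _ _ k); [|exact/negbTE|].
  by rewrite bb' ltxx.
Qed.

Lemma real_surj_bits : exists f : R -> nat -> bool, forall b, exists r, f r = b.
Proof.
have /choice[f fP] (r : R) : exists b, (exists b', ternary b' = r) -> ternary b = r.
  have [[b br]|nb] := pselect (exists b', ternary b' = r); first by exists b.
  by exists (fun=> false) => /nb.
exists f => b; exists (ternary b); apply: ternary_inj.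
by apply: fP; exists b.
Qed.

(** Bits select a set of rationals, and a real is the supremum of the rationals below it. *)
Lemma bits_surj_real : exists h : (nat -> bool) -> R, forall r, exists b, h b = r.
Proof.
exists (fun b => sup [set ratr q | q in [set q : rat | b (pickle q)]]) => r.
exists (fun k => if unpickle k is Some q then ratr q < r else false).
set S := [set _ | _ in _].
have SP q : ratr q < r -> S (ratr q) by move=> qr; exists q => //=; rewrite pickleK.
have Sub : ubound S r by move=> _ [q /= + <-]; rewrite pickleK => /ltW.
have [q /andP[_ qr]] : exists q : rat, r - 1 < ratr q < r.
  by have := @rat_in_itvoo R (r - 1) r; case; [lra|move=> q; rewrite in_itv; exists q].
apply/le_anti/andP; split; first by apply: ge_sup => //; exists (ratr q); apply: SP.
rewrite leNgt; apply/negP => /rat_in_itvoo[p]; rewrite in_itv/= => /andP[Sp pr].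
move: Sp; rewrite ltNge => /negP; apply; apply: ub_le_sup; last exact: SP.
by exists r.
Qed.

(** A real codes a bit sequence, which a pairing of the indices splits into countably many bit
    sequences, each coding a real. *)
Lemma real_surj_sequences : exists f : R -> nat -> R, forall e, exists r, f r = e.
Proof.
have [f fP] := real_surj_bits; have [h hP] := bits_surj_real.
exists (fun r k => h (fun j => f r (pickle (k, j)))) => e.
have /choice[b bP] k := hP (e k).
have [r rP] := fP (fun m => if (unpickle m : option (nat * nat)) is Some (k, j) then b k j else false).
exists r; apply: funext => k; rewrite -bP; congr h; apply: funext => j.
by rewrite rP pickleK.
Qed.

Lemma real_surj_row_sequences n : exists f : R -> (nat -> 'rV[R]_n) * (nat -> 'rV[R]_n),
  forall c, exists r, f r = c.
Proof.
have [f fP] := real_surj_sequences.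
exists (fun r => (fun k => \row_i f r (pickle (k, i, true)), fun k => \row_i f r (pickle (k, i, false)))).
move=> [a b].
have [r rP] := fP (fun m => if (unpickle m : option (nat * 'I_n * bool)) is Some (k, i, s)
                            then (if s then a k else b k) 0 i else 0).
by exists r; congr pair; apply: funext => k; apply/rowP => i; rewrite mxE rP pickleK.
Qed.

(** Cantor's diagonal argument, on coordinate [i] of the [k]-th vector. *)
Lemma row_sequences_uncountable n : (0 < n)%N ->
  forall e : nat -> (nat -> 'rV[R]_n) * (nat -> 'rV[R]_n), exists c, forall k, e k <> c.
Proof.
move=> n0 e; pose i := Ordinal n0.
exists (fun k => const_mx (if (e k).1 k 0 i == 0 then 1 else 0), fun=> 0) => k /(congr1 fst) /=.
move=> /(congr1 (fun g : nat -> 'rV[R]_n => g k 0 i)); rewrite mxE; case: eqP => [->|//] /eqP.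
by rewrite eq_sym oner_eq0.
Qed.

End Continuum.

(** * Measure on the line *)

Section Line.
Context {R : realType}.
Local Notation mu := (@lebesgue_measure R).
Local Open Scope ereal_scope.

Lemma lebesgue_measure_shift (t : R) (A : set R) : measurable A ->
  pushforward mu ((fun x => x + t)%R : _ -> measurableTypeR R) A = mu A.
Proof.
have mt : measurable_fun [set: measurableTypeR R] ((fun x => x + t)%R : _ -> measurableTypeR R).
  by apply: measurable_funD.
move=> mA; apply/esym.
apply: (lebesgue_measure_unique (mu := pushforward mu ((fun x => x + t)%R : _ -> measurableTypeR R))) => //.
move=> _ [[a b]] _ <-; transitivity (mu `](a - t)%R, (b - t)%R]%classic).
  rewrite !lebesgue_measure_itv/= !lte_fin ltrD2r; case: ifP => // _.
  by rewrite -!EFinB; congr EFin; lra.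
apply: (congr1 mu); apply/seteqP; split => x; rewrite /= !in_itv/= ltrBlDr lerBrDr//.
Qed.

(* Infinitely many of the translates [E + t / (m + 1)] fit into a bounded
   interval, so two of them meet. *)
Lemma positive_measure_differences (E : set R) (a b t : R) :
  measurable E -> E `<=` `]a, b] -> 0 < mu E ->
  exists e e' m m', [/\ E e, E e' &
    t = ((e' - e) / (m.+1%:R^-1 - m'.+1%:R^-1))%R].
Proof.
move=> mE Eab E0; apply: contrapT => noE.
pose s m : R := (- (t / m.+1%:R))%R.
pose F m := (fun x => x + s m)%R @^-1` E.
have mF m : measurable (F m).
  have ms : measurable_fun [set: R] (fun x => x + s m)%R by apply: measurable_funD.
  by rewrite -[F m]setTI; exact: ms.
have tF : trivIset [set: nat] F.
  apply/trivIsetP => m m' _ _ mm'; rewrite -subset0 => x [Em Em'].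
  apply: noE; exists (x + s m)%R, (x + s m')%R, m, m'; split=> //.
  rewrite /s; set u := (m.+1%:R^-1 : R)%R; set u' := (m'.+1%:R^-1 : R)%R.
  have uu' : (u - u' != 0)%R.
    rewrite subr_eq0; apply: contra_neq mm' => /invr_inj /eqP.
    by rewrite eqr_nat => /eqP[].
  by field.
pose L := (b - a + 2 * `|t|)%R.
have FL : \bigcup_m F m `<=` `](a - `|t|)%R, (b + `|t|)%R].
  move=> x [m _ /= /Eab]; rewrite /= !in_itv/= /s => /andP[ax xb].
  have : (`|t / m.+1%:R| <= `|t|)%R.
    by rewrite normrM ler_piMr// normfV ger0_norm// invf_le1// ler1n.
  move: (t / _)%R ax xb => u ax xb; rewrite ler_norml => /andP[h1 h2].
  by apply/andP; split; lra.
have mUF : measurable (\bigcup_m F m) by apply: bigcup_measurable => m _; exact: mF.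
have muFL : mu (\bigcup_m F m) < +oo.
  apply: (@le_lt_trans _ _ (mu (`](a - `|t|)%R, (b + `|t|)%R]))).
    by apply: le_measure => //; rewrite inE.
  by rewrite lebesgue_measure_itv/=; case: ifP => // _; rewrite ltry.
move: muFL; rewrite measure_semi_bigcup//.
rewrite (eq_eseriesr (g := fun=> mu E)); last first.
  by move=> m _; exact: lebesgue_measure_shift.
have part N := @nneseries_lim_ge R (fun=> mu E) xpredT 0%N N (fun _ _ _ => ltW E0).
set tot := limn _ in part *; move=> totoo.
have tot0 : 0 <= tot by exact: nneseries_ge0.
have totfin : tot \is a fin_num by rewrite ge0_fin_numE.
have Efin : mu E \is a fin_num.
  rewrite ge0_fin_numE ?ltW//; apply: le_lt_trans totoo.
  by have := part 1%N; rewrite big_nat1.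
move: part; rewrite -(fineK Efin) -(fineK totfin) => part.
have e0 : (0 < fine (mu E))%R by rewrite fine_gt0// E0 -ge0_fin_numE// ltW.
have := part (Num.bound (fine tot / fine (mu E))).
rewrite sumEFin sumr_const_nat subn0 lee_fin -mulr_natl -ler_pdivlMr// leNgt.
by rewrite archi_boundP// divr_ge0// ?fine_ge0// ltW.
Qed.

(** The Fubini step: [w j] is the volume of a section of the [j]-th box and [V] that of the large
    box. If the section sum were at least [V] almost everywhere on []a, b]], integrating it would
    give at least [(b - a) * V]. *)
Lemma slice_positive (c d w : nat -> R) (a b V : R) :
  (forall j, c j <= d j)%R -> (forall j, 0 <= w j)%R -> (a < b)%R -> (0 <= V)%R ->
  \sum_(j <oo) (w j * (d j - c j))%:E < ((b - a) * V)%:E ->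
  let E := `]a, b] `&` [set t | \sum_(j <oo) (w j * (c j < t <= d j)%R%:R)%:E < V%:E] in
  measurable E /\ 0 < mu E.
Proof.
move=> cd w0 ab V0 sumV.
pose f j (t : R) : \bar R := (w j)%:E * (\1_(`]c j, d j]) t)%:E.
have fE t : \sum_(j <oo) (w j * (c j < t <= d j)%R%:R)%:E = \sum_(j <oo) f j t.
  by apply: eq_eseriesr => j _; rewrite /f indicE mem_setE in_itv.
have f0 j t : 0 <= f j t by rewrite /f -EFinM lee_fin mulr_ge0.
have mf D j : measurable_fun D (f j).
  apply: emeasurable_funM => //; apply/measurable_EFinP.
  exact: measurable_indic.
have mS D : measurable_fun D (fun t => \sum_(j <oo) f j t).
  by apply: ge0_emeasurable_sum => //.
move=> E.
have mI : measurable (`]a, b] : set R) by [].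
have mE : measurable E.
  have -> : E = `]a, b] `&` [set t | \sum_(j <oo) f j t < V%:E].
    by apply/seteqP; split => t; rewrite /E /= fE.
  exact: emeasurable_fun_infty_o.
split=> //; rewrite lt0e measure_ge0 andbT; apply/eqP => E0.
have mD : measurable (`]a, b] `\` E) by exact: measurableD.
have muD : mu (`]a, b] `\` E) = (b - a)%:E.
  rewrite measureD//=; last by rewrite lebesgue_measure_itv/= lte_fin ab ltry.
  rewrite setIidr; last by move=> t [].
  by rewrite E0 sube0 lebesgue_measure_itv/= lte_fin ab.
move: sumV; apply/negP; rewrite -leNgt.
have -> : ((b - a) * V)%:E = \int[mu]_(t in `]a, b] `\` E) cst V%:E t.
  by rewrite integral_cst// [X in _ * X]muD -EFinM mulrC.
apply: (@le_trans _ _ (\int[mu]_(t in `]a, b] `\` E) \sum_(j <oo) f j t)).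
  apply: ge0_le_integral => //; first exact: mS.
  by move=> t [tab]; rewrite /E/= => /not_andP[//|] /negP; rewrite -leNgt fE.
apply: (@le_trans _ _ (\int[mu]_t \sum_(j <oo) f j t)).
  by apply: ge0_subset_integral => //; [exact: mS|move=> t _; exact: nneseries_ge0].
rewrite integral_nneseries//; last by move=> j; exact: mf.
apply: lee_nneseries => [j _ _|j _].
  by apply: integral_ge0.
rewrite /f ge0_integralZl//.
- have mi : mu `]c j, d j] = (d j - c j)%:E.
    rewrite lebesgue_measure_itv/= lte_fin; case: ltP => // dc.
    by congr EFin; have := cd j; lra.
  by rewrite integral_indic// setIT [X in _ * X]mi.
- by apply/measurable_EFinP; exact: measurable_indic.
- by rewrite lee_fin.
Qed.
End Line.

(** * Avoiding zero sets of polynomials *)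

Lemma poly_roots_sub_seq (R : idomainType) (p : {poly R}) : p != 0 ->
  exists s : seq R, forall x, p.[x] = 0 -> x \in s.
Proof.
elim: {p}(size p) {-2}p (leqnn (size p)) => [p|N IHN p] sp p0.
  by move: p0; rewrite -size_poly_eq0 -leqn0 sp.
have [[x px]|nx] := pselect (exists x, root p x); last first.
  by exists [::] => x /eqP px; case: nx; exists x.
have /factor_theorem[q pq] := px.
have q0 : q != 0 by apply: contra_neq p0 => q0; rewrite pq q0 mul0r.
have [|//|s sP] := IHN q.
  by move: sp; rewrite pq size_Mmonic ?monicXsubC// size_XsubC addn2 ltnS.
exists (x :: s) => y; rewrite pq hornerM hornerXsubC inE => /eqP.
by rewrite mulf_eq0 subr_eq0 orbC => /orP[->//|/eqP/sP ->]; rewrite orbT.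
Qed.

(** Otherwise each point of [E] is coded by some [j] and an index in [s j], while two points of [E]
    and two natural numbers code any real, so [J] would dominate the reals. *)
Lemma avoid_finite_sets (R : realType) (U : eqType) (J : set U) (s : U -> seq R)
    (E : set R) (a b : R) :
  measurable E -> E `<=` `]a, b] -> (0 < lebesgue_measure E)%E ->
  ~ dominated [set: R] J -> exists2 x, E x & forall j, J j -> x \notin s j.
Proof.
move=> mE Eab E0; apply: contra_notP => noE.
apply: (@dominated_trans _ R _ _ E); last first.
  exists (fun k l => if l is j :: _ then nth 0 (s j) k else 0) => x Ex.
  have [j Jj xj] : exists2 j, J j & x \in s j.
    apply: contrapT => nj; apply: noE; exists x => // j Jj.
    by apply/negP => xj; apply: nj; exists j.
  exists (index x (s j)), [:: j]; split; last by rewrite nth_index.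
  by move=> u; rewrite inE => /eqP->.
exists (fun k l => if (unpickle k : option (nat * nat)) is Some (m, m')
  then (l`_1 - l`_0) / (m.+1%:R^-1 - m'.+1%:R^-1) else 0) => t _.
have [e [e' [m [m' [Ee Ee' ->]]]]] := positive_measure_differences t mE Eab E0.
exists (pickle (m, m')), [:: e; e']; split; last by rewrite pickleK.
by move=> u; rewrite !inE => /orP[] /eqP->.
Qed.

Section Avoidance.
Context {R : realType} {n : nat}.
Implicit Types (x z : 'rV[R]_n) (g : 'rV[R]_n -> R).

Definition set_coord z (i : 'I_n) (t : R) : 'rV[R]_n :=
  \row_j (if j == i then t else z 0 j).

(** Coordinates are chosen one at a time, so only the dependence on a single coordinate with the
    others frozen matters. *)
Definition separately_polynomial g :=
  forall z i, exists p : {poly R}, forall t, g (set_coord z i t) = p.[t].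

Lemma separately_polynomial_cst (c : R) : separately_polynomial (fun=> c).
Proof. by move=> z i; exists c%:P => t; rewrite hornerC. Qed.

Lemma separately_polynomial_coord j : separately_polynomial (fun z => z 0 j).
Proof.
move=> z i; have [ji|ji] := eqVneq j i.
  by exists 'X => t; rewrite mxE ji eqxx hornerX.
by exists (z 0 j)%:P => t; rewrite mxE (negbTE ji) hornerC.
Qed.

Lemma separately_polynomialM g h :
  separately_polynomial g -> separately_polynomial h ->
  separately_polynomial (fun z => g z * h z).
Proof.
move=> gP hP z i; have [p pP] := gP z i; have [q qP] := hP z i.
by exists (p * q) => t; rewrite hornerM pP qP.
Qed.

Lemma separately_polynomialB g h :
  separately_polynomial g -> separately_polynomial h ->
  separately_polynomial (fun z => g z - h z).
Proof.
move=> gP hP z i; have [p pP] := gP z i; have [q qP] := hP z i.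
by exists (p - q) => t; rewrite hornerD hornerN pP qP.
Qed.

Lemma separately_polynomial_sum (g : 'I_n -> 'rV[R]_n -> R) :
  (forall j, separately_polynomial (g j)) ->
  separately_polynomial (fun z => \sum_j g j z).
Proof.
move=> gP z i; have /choice[p pP] j := gP j z i.
by exists (\sum_j p j) => t; rewrite horner_sum; apply: eq_bigr.
Qed.

(* The coordinates of the point are chosen one after the other. The boxes that
   meet the slice fixed so far are weighted by the volume of their section, and
   Fubini leaves a positive measure of admissible values for the next one. *)
Lemma avoid_zero_sets (U : eqType) (J : set U) (g : U -> 'rV[R]_n -> R)
    (a b : 'rV[R]_n) (c d : nat -> 'rV[R]_n) :
  (forall i, a 0 i < b 0 i) -> (forall k i, c k 0 i <= d k 0 i) ->
  (\sum_(k <oo) (box_volume (c k) (d k))%:E < (box_volume a b)%:E)%E ->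
  (forall j, J j -> separately_polynomial (g j)) ->
  (forall j, J j -> exists z, g j z != 0) ->
  ~ dominated [set: R] J ->
  exists x, [/\ box a b x, forall k, ~ box (c k) (d k) x &
    forall j, J j -> g j x != 0].
Proof.
move=> ab cd sumV gpoly gnz Jsmall.
(* The product of [term m x k] is the volume of the section of the [k]-th box at the first [m]
   coordinates of [x], zero if they miss the box; [side m] does the same for the box from [a] to
   [b]. *)
pose term m x k (i : 'I_n) : R :=
  if (i < m)%N then (c k 0 i < x 0 i <= d k 0 i)%R%:R else d k 0 i - c k 0 i.
pose side m (i : 'I_n) : R := if (i < m)%N then 1 else b 0 i - a 0 i.
have term0 m x k i : 0 <= term m x k i.
  by rewrite /term; case: ifP => // _; rewrite subr_ge0.
have side0 m i : 0 < side m i by rewrite /side; case: ifP => // _; rewrite subr_gt0.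
(* Besides the volume inequality for sections, the invariant keeps each [g j] from vanishing
   identically on the slice fixed so far. *)
have inv m : (m <= n)%N -> exists x, [/\
    forall i : 'I_n, (i < m)%N -> a 0 i < x 0 i <= b 0 i,
    (\sum_(k <oo) (\prod_i term m x k i)%:E < (\prod_i side m i)%:E)%E &
    forall j, J j -> exists2 z : 'rV[R]_n, (forall i : 'I_n, (i < m)%N -> z 0 i = x 0 i) & g j z != 0].
  elim: m => [_|m IHm mn].
    by exists 0; split => // j /gnz[z gz]; exists z.
  have [x [xab xsum xg]] := IHm (ltnW mn).
  pose i0 := Ordinal mn.
  pose w k := \prod_(i | i != i0) term m x k i.
  pose V := \prod_(i | i != i0) side m i.
  have i0m (i : 'I_n) : i != i0 -> (i < m.+1)%N = (i < m)%N.
    move=> ii0; rewrite ltnS leq_eqVlt; suff /negbTE -> : (i : nat) != m by [].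
    by apply: contra_neq ii0 => im; apply: val_inj.
  have termS t k : \prod_i term m.+1 (set_coord x i0 t) k i =
      w k * (c k 0 i0 < t <= d k 0 i0)%R%:R.
    rewrite (bigD1 i0)//= mulrC; congr (_ * _); last first.
      by rewrite /term ltnSn mxE eqxx.
    by apply: eq_bigr => i ii0; rewrite /term i0m// mxE (negbTE ii0).
  have sideS : \prod_i side m.+1 i = V.
    rewrite (bigD1 i0)//= /side ltnSn mul1r.
    by apply: eq_bigr => i ii0; rewrite i0m.
  have w0 k : 0 <= w k by apply: prodr_ge0.
  have V0 : 0 <= V by apply: prodr_ge0 => i _; apply: ltW.
  have sumw : (\sum_(k <oo) (w k * (d k 0 i0 - c k 0 i0))%:E <
               ((b 0 i0 - a 0 i0) * V)%:E)%E.
    move: xsum; rewrite [X in (_ < X%:E)%E](bigD1 i0)//= {1}/side ltnn.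
    congr (_ < _)%E; apply: eq_eseriesr => k _.
    by rewrite (bigD1 i0)//= {1}/term ltnn mulrC.
  have [] := slice_positive (fun k => cd k i0) w0 (ab i0) V0 sumw.
  set E := _ `&` _ => mE E0.
  have /choice[zz zzP] j : exists z : 'rV[R]_n, J j ->
      (forall i : 'I_n, (i < m)%N -> z 0 i = x 0 i) /\ g j z != 0.
    have [/xg[z zx gz]|nJ] := pselect (J j); first by exists z.
    by exists 0 => /nJ.
  (* On the line through [zz j] in direction [i0] the polynomial is not zero, so only the finitely
     many values in [s j] could break the invariant. *)
  have /choice[s sP] j : exists s : seq R, J j ->
      forall t, g j (set_coord (zz j) i0 t) = 0 -> t \in s.
    have [Jj|nJ] := pselect (J j); last by exists [::] => /nJ.
    have [p pP] := gpoly j Jj (zz j) i0.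
    have [s sP] : exists s : seq R, forall t, p.[t] = 0 -> t \in s.
      apply: poly_roots_sub_seq; apply: contra_neq (zzP j Jj).2 => p0.
      have <- : set_coord (zz j) i0 (zz j 0 i0) = zz j.
        by apply/rowP => i; rewrite mxE; case: eqP => // ->.
      by rewrite pP p0 horner0.
    by exists s => _ t; rewrite pP; apply: sP.
  have Eab : E `<=` `]a 0 i0, b 0 i0] by move=> t [].
  have [t [tab tsum] ts] := avoid_finite_sets s mE Eab E0 Jsmall.
  exists (set_coord x i0 t); split.
  - move=> i im; rewrite mxE; case: eqP => [->|/eqP ii0]; first by move: tab; rewrite /= in_itv.
    by apply: xab; rewrite -i0m.
  - by rewrite sideS; under eq_eseriesr do rewrite termS.
  - move=> j Jj; exists (set_coord (zz j) i0 t); last first.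
      by apply: contraNneq (ts j Jj) => /(sP j Jj).
    move=> i im; rewrite !mxE; case: eqP => // /eqP ii0.
    by apply: (zzP j Jj).1; rewrite -i0m.
(* Once all coordinates are fixed, sections have volume 0 or 1 and sum to less than 1, so no box
   contains [x]; the slice is reduced to [x] itself. *)
have [x [xab xsum xg]] := inv n (leqnn n).
exists x; split.
- by move=> i; apply: xab.
- move=> k xk; move: xsum; rewrite [X in (_ < X%:E)%E]big1; last first.
    by move=> i _; rewrite /side ltn_ord.
  apply/negP; rewrite -leNgt.
  have t0 j : (0 <= (\prod_i term n x j i)%:E)%E by rewrite lee_fin; apply: prodr_ge0.
  apply: le_trans (@nneseries_lim_ge R _ xpredT 0%N k.+1 (fun j _ _ => t0 j)).
  rewrite big_nat_recr//= [X in (_ <= _ + X%:E)%E]big1; first by rewrite leeDr// sume_ge0.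
  by move=> i _; rewrite /term ltn_ord xk.
- move=> j /xg[z zx]; suff -> : z = x by [].
  by apply/rowP => i; apply: zx.
Qed.

End Avoidance.

(** * Angles *)

Section Angle.
Context {R : realType} {n : nat}.
Implicit Types (u v w x y z : 'rV[R]_n) (c : R).

Lemma dotvC u v : dotv u v = dotv v u.
Proof. by apply: eq_bigr => i _; rewrite mulrC. Qed.

Lemma dotvDl u v w : dotv (u + v) w = dotv u w + dotv v w.
Proof. by rewrite -big_split; apply: eq_bigr => i _; rewrite mxE mulrDl. Qed.

Lemma dotvZl (k : R) u v : dotv (k *: u) v = k * dotv u v.
Proof. by rewrite mulr_sumr; apply: eq_bigr => i _; rewrite mxE mulrA. Qed.

Lemma dotvDr u v w : dotv w (u + v) = dotv w u + dotv w v.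
Proof. by rewrite dotvC dotvDl !(dotvC w). Qed.

Lemma dotvZr (k : R) u v : dotv v (k *: u) = k * dotv v u.
Proof. by rewrite dotvC dotvZl dotvC. Qed.

Lemma dotv_ge0 u : 0 <= dotv u u.
Proof. by apply: sumr_ge0 => i _; rewrite -expr2 sqr_ge0. Qed.

Lemma dotv_eq0 u : (dotv u u == 0) = (u == 0).
Proof.
apply/eqP/eqP => [u0|->]; last by apply: big1 => i _; rewrite mxE mul0r.
apply/rowP => i; rewrite mxE; apply/eqP; rewrite -sqrf_eq0 expr2.
move/eqP: u0; rewrite psumr_eq0; last by move=> j _; rewrite -expr2 sqr_ge0.
by move=> /allP/(_ i); rewrite mem_index_enum; apply.
Qed.

Lemma dotv_gt0 u : u != 0 -> 0 < dotv u u.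
Proof. by move=> u0; rewrite lt0r dotv_eq0 u0 dotv_ge0. Qed.

Lemma dotv_cauchy_schwarz u v : dotv u v ^+ 2 <= dotv u u * dotv v v.
Proof.
have [->|v0] := eqVneq v 0.
  by rewrite -[0](scale0r 0) dotvZr mul0r expr0n/= mulr_ge0 ?dotv_ge0.
have V0 := dotv_gt0 v0.
have := dotv_ge0 (dotv v v *: u + - dotv u v *: v).
rewrite !(dotvDl, dotvDr, dotvZl, dotvZr) (dotvC v u) => h.
rewrite -subr_ge0 -(pmulr_lge0 _ V0); apply: le_trans h _.
by rewrite le_eqVlt; apply/orP; left; apply/eqP; ring.
Qed.

(* For [y, z != x], vanishes exactly when the cosine of the angle at [x] is
   [c] or [- c]. *)
Definition angle_form c x y z : R :=
  dotv (y - x) (z - x) ^+ 2 - c ^+ 2 * (dotv (y - x) (y - x) * dotv (z - x) (z - x)).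

Lemma angle_formC c x y z : angle_form c x y z = angle_form c x z y.
Proof. by rewrite /angle_form dotvC; congr (_ - _ * _); rewrite mulrC. Qed.

Lemma angle_form_eq0 x y z : x != y -> x != z ->
  angle_form (cos (angle (y - x) (z - x))) x y z = 0.
Proof.
move=> xy xz; rewrite /angle_form /angle.
have U0 : 0 < dotv (y - x) (y - x) by rewrite dotv_gt0// subr_eq0 eq_sym.
have V0 : 0 < dotv (z - x) (z - x) by rewrite dotv_gt0// subr_eq0 eq_sym.
set r := _ / _.
have r2 : r ^+ 2 = dotv (y - x) (z - x) ^+ 2 / (dotv (y - x) (y - x) * dotv (z - x) (z - x)).
  by rewrite /r expr_div_n exprMn !sqr_sqrtr// ltW.
have UV0 := mulr_gt0 U0 V0.
(* That [r] lies in [[-1, 1]], where [cos] undoes [acos], is the Cauchy-Schwarz inequality. *)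
rewrite acosK; last first.
  rewrite in_itv/= -ler_norml -(@ler_pXn2r _ 2)// ?nnegrE//.
  by rewrite real_normK ?num_real// r2 expr1n ler_pdivrMr// mul1r dotv_cauchy_schwarz.
by rewrite r2 divfK ?subrr// gt_eqF.
Qed.

Lemma dotv_orthogonal u : (1 < n)%N -> exists2 w, w != 0 & dotv u w = 0.
Proof.
move=> n1; pose i := Ordinal (ltnW n1); pose j := Ordinal n1.
have ji : (j == i) = false by [].
have dotE w : (forall k, k != i -> k != j -> w 0 k = 0) ->
    dotv u w = u 0 i * w 0 i + u 0 j * w 0 j.
  move=> w0; rewrite /dotv (bigD1 i)//= (bigD1 j)/= ?ji// big1 ?addr0// => k.
  by move=> /andP[ki kj]; rewrite w0// mulr0.
have [ui|ui] := eqVneq (u 0 i) 0.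
  exists (\row_k (k == i)%:R).
    by apply/eqP => /rowP/(_ i)/eqP; rewrite !mxE eqxx oner_eq0.
  rewrite dotE => [|k ki _]; rewrite !mxE ?(negbTE ki)//.
  by rewrite ui mul0r add0r ji mulr0.
exists (\row_k (if k == i then - u 0 j else if k == j then u 0 i else 0)).
  apply/eqP => /rowP/(_ j)/eqP; rewrite !mxE ji eqxx.
  by rewrite (negbTE ui).
rewrite dotE => [|k ki kj]; last by rewrite mxE (negbTE ki) (negbTE kj).
by rewrite !mxE eqxx ji eqxx; ring.
Qed.

(** Take [z = x + s u + t w] with [u = y - x] and [w] orthogonal to [u]. For [c = 0] the choice
    [s = 2], [t = 1] gives no right angle at [x] or [z]. For [c != 0] take [s = 0]: the angle at [x]
    is right, and the form at [z] vanishes for at most one value of [t ^+ 2], so [t = 1] or [t = 2]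
    works. *)
Lemma angle_form_neq0 c x y : (1 < n)%N -> x != y ->
  exists z, angle_form c x y z * angle_form c z x y != 0.
Proof.
move=> n1 xy; have [w w0 uw] := dotv_orthogonal (y - x) n1.
have U0 : 0 < dotv (y - x) (y - x) by rewrite dotv_gt0// subr_eq0 eq_sym.
have W0 := dotv_gt0 w0.
have [u uE] : exists u, u = y - x by exists (y - x).
rewrite -uE in uw U0.
have E s t : let z := x + (s *: u + t *: w) in
    angle_form c x y z * angle_form c z x y =
    ((s * dotv u u) ^+ 2 - c ^+ 2 * (dotv u u * (s ^+ 2 * dotv u u + t ^+ 2 * dotv w w))) *
    ((t ^+ 2 * dotv w w - s * (1 - s) * dotv u u) ^+ 2 -
     c ^+ 2 * ((s ^+ 2 * dotv u u + t ^+ 2 * dotv w w) *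
               ((1 - s) ^+ 2 * dotv u u + t ^+ 2 * dotv w w))).
  move=> z; rewrite /angle_form.
  have -> : z - x = s *: u + t *: w by rewrite /z addrC addKr.
  have -> : x - z = - s *: u + - t *: w.
    by rewrite /z opprD addNKr opprD !scaleNr.
  have -> : y - z = (1 - s) *: u + - t *: w.
    rewrite /z opprD addrA -uE opprD addrA scaleNr; congr (_ + _).
    by rewrite scalerBl scale1r.
  rewrite -uE !(dotvDl, dotvDr, dotvZl, dotvZr) (dotvC w u) uw; ring.
have [c0|c0] := eqVneq c 0.
  exists (x + (2 *: u + 1 *: w)); rewrite E c0 expr0n/= !mul0r !subr0.
  by rewrite mulf_neq0// expf_neq0// gt_eqF//; nra.
have c2 : 0 < c ^+ 2 by rewrite exprn_even_gt0.
have E0 t : t != 0 -> t ^+ 2 * dotv w w * (1 - c ^+ 2) != c ^+ 2 * dotv u u ->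
    exists z, angle_form c x y z * angle_form c z x y != 0.
  move=> t0 neq; exists (x + (0 *: u + t *: w)); rewrite E.
  have t2 : 0 < t ^+ 2 by rewrite exprn_even_gt0.
  rewrite mulf_neq0//.
    rewrite (_ : _ - _ = - (c ^+ 2 * dotv u u * t ^+ 2 * dotv w w)); last by ring.
    by rewrite oppr_eq0 !mulf_neq0// gt_eqF.
  rewrite (_ : _ - _ = t ^+ 2 * dotv w w *
    (t ^+ 2 * dotv w w * (1 - c ^+ 2) - c ^+ 2 * dotv u u)); last by ring.
  by rewrite !mulf_neq0// ?subr_eq0// gt_eqF.
have [e1|] := eqVneq (1 ^+ 2 * dotv w w * (1 - c ^+ 2)) (c ^+ 2 * dotv u u); last exact: E0.
apply: (E0 2) => //; rewrite -e1; apply/eqP => e2.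
by have := mulr_gt0 c2 U0; rewrite -e1; move: e2; lra.
Qed.

Lemma separately_polynomial_dotv (f h : 'rV[R]_n -> 'rV[R]_n) :
  (forall i, separately_polynomial (fun z => f z 0 i)) ->
  (forall i, separately_polynomial (fun z => h z 0 i)) ->
  separately_polynomial (fun z => dotv (f z) (h z)).
Proof.
move=> fP hP; apply: separately_polynomial_sum => i.
exact: separately_polynomialM.
Qed.

Lemma separately_polynomial_sub (f h : 'rV[R]_n -> 'rV[R]_n) :
  (forall i, separately_polynomial (fun z => f z 0 i)) ->
  (forall i, separately_polynomial (fun z => h z 0 i)) ->
  forall i, separately_polynomial (fun z => (f z - h z) 0 i).
Proof.
move=> fP hP i; rewrite (_ : (fun z => _) = fun z => f z 0 i - h z 0 i).
  exact: separately_polynomialB.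
by apply: funext => z; rewrite !mxE.
Qed.

Lemma separately_polynomial_angle_form c (f g h : 'rV[R]_n -> 'rV[R]_n) :
  (forall i, separately_polynomial (fun z => f z 0 i)) ->
  (forall i, separately_polynomial (fun z => g z 0 i)) ->
  (forall i, separately_polynomial (fun z => h z 0 i)) ->
  separately_polynomial (fun z => angle_form c (f z) (g z) (h z)).
Proof.
move=> fP gP hP; have gf := separately_polynomial_sub gP fP.
have hf := separately_polynomial_sub hP fP.
have gfhf := separately_polynomial_dotv gf hf.
have gfgf := separately_polynomial_dotv gf gf.
have hfhf := separately_polynomial_dotv hf hf.
apply: separately_polynomialB; first exact: separately_polynomialM.
apply: separately_polynomialM; first exact: separately_polynomial_cst.
exact: separately_polynomialM.
Qed.

End Angle.

(** * Outer measure *)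

Definition meets_large_boxes {R : realType} {n : nat} (H : set 'rV[R]_n) : Prop :=
  forall (a b : 'rV[R]_n) (c d : nat -> 'rV[R]_n),
    (forall i, a 0 i < b 0 i) -> (forall k i, c k 0 i <= d k 0 i) ->
    (\sum_(k <oo) (box_volume (c k) (d k))%:E < (box_volume a b)%:E)%E ->
    exists2 x, H x & box a b x /\ forall k, ~ box (c k) (d k) x.

Lemma box_volume_id (R : realType) (n : nat) (a : 'rV[R]_n) :
  (0 < n)%N -> box_volume a a = 0.
Proof.
by move=> n0; rewrite /box_volume (bigD1 (Ordinal n0))//= subrr mul0r.
Qed.

Lemma angle_form_free_set (R : realType) (n : nat) (c : R) : (1 < n)%N ->
  exists H : set 'rV[R]_n, meets_large_boxes H /\
    forall x y z, H x -> H y -> H z -> x != y -> x != z -> y != z ->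
      angle_form c x y z != 0.
Proof.
move=> n1; pose T : eqType := ((nat -> 'rV[R]_n) * (nat -> 'rV[R]_n))%type.
(* Entry [0] of the two sequences is the box to be met, entry [k.+1] the [k]-th box to be
   removed. *)
pose valid (t : T) := [/\ forall i, t.1 0%N 0 i < t.2 0%N 0 i,
  forall k i, t.1 k.+1 0 i <= t.2 k.+1 0 i &
  (\sum_(k <oo) (box_volume (t.1 k.+1) (t.2 k.+1))%:E <
   (box_volume (t.1 0%N) (t.2 0%N))%:E)%E].
pose hits (t : T) x := box (t.1 0%N) (t.2 0%N) x /\
  forall k, ~ box (t.1 k.+1) (t.2 k.+1) x.
pose bad (x y z : 'rV[R]_n) := [\/ angle_form c x y z = 0, angle_form c y x z = 0 |
  angle_form c z x y = 0].
have n0 : (0 < n)%N by apply: ltnW.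
(* The unit cube with degenerate removed boxes; it replaces invalid data, since the selection asks
   for a point at every step. *)
pose t0 : T := (fun=> 0, fun k => if k == 0%N then const_mx 1 else 0).
have t0valid : valid t0.
  split=> /= [i|k i|]; [by rewrite !mxE ltr01|by rewrite mxE|].
  rewrite eseries0 => [|k _ _]; last by rewrite box_volume_id.
  by rewrite lte_fin; apply: prodr_gt0 => i _; rewrite !mxE subr0.
have [||||H [Hhits Hbad]] := @transfinite_selection T 'rV[R]_n t0
    (fun t x => valid t -> hits t x) bad.
- move=> [phi phiP]; have [t tP] := row_sequences_uncountable n0 (fun k => phi k [::]).
  have [k [[|u l] [l0 phit]]] := phiP t I; first exact: (tP k).
  by have := l0 u; rewrite mem_head => /(_ isT).
- by move=> x y z [] h; [apply: Or32|apply: Or31|apply: Or33; rewrite angle_formC].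
- by move=> x y z [] h; [apply: Or31; rewrite angle_formC|apply: Or33|apply: Or32].
- move=> P t Psmall.
  pose J := [set p : 'rV[R]_n * 'rV[R]_n | [/\ P p.1, P p.2 & p.1 != p.2]].
  (* Pairs from [P] are coded over [P], and the reals code all of [T]; if [J] dominated the reals,
     [P] would dominate [T]. *)
  have Jsmall : ~ dominated [set: R] J.
    apply: contra_not Psmall => RJ.
    have [f fP] := @real_surj_row_sequences R n.
    apply: (@dominated_trans _ R _ _ [set: R]).
      apply: dominated_sub (dominated_image t0 setT f) => // s _.
      by have [r <-] := fP s; exists r.
    apply: (dominated_trans RJ); exists (fun _ l => (nth 0 l 0, nth 0 l 1)) => -[x y] [Px Py _].
    by exists 0%N, [:: x; y]; split=> // u; rewrite !inE => /orP[] /eqP->.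
  pose g (p : 'rV[R]_n * 'rV[R]_n) z := angle_form c p.1 p.2 z * angle_form c z p.1 p.2.
  have gpoly p : separately_polynomial (g p).
    have idP i := @separately_polynomial_coord R n i.
    have cP (x : 'rV[R]_n) i := @separately_polynomial_cst R n (x 0 i).
    have := @separately_polynomial_angle_form R n c id (fun=> p.1) (fun=> p.2)
      idP (cP p.1) (cP p.2).
    apply: separately_polynomialM.
    exact: (@separately_polynomial_angle_form R n c (fun=> p.1) (fun=> p.2) id).
  have [s [svalid st]] : exists s, valid s /\ (valid t -> s = t).
    by have [tv|tnv] := pselect (valid t); [exists t|exists t0].
  have [s1 s2 s3] := svalid.
  have [||x [xs1 xs2 xg]] := avoid_zero_sets (g := g) s1 s2 s3 _ _ Jsmall.
  + by move=> p _.
  + by move=> p [_ _ np]; exact: angle_form_neq0.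
  exists x; split => [/st <-//|y z Py Pz /eqP yz].
  (* The pair [(y, z)] excludes the angle at [y] and at [x]; the swapped pair excludes it at [z]. *)
  have := xg (y, z) (And3 Py Pz yz); have zy : z != y by rewrite eq_sym.
  have := xg (z, y) (And3 Pz Py zy); rewrite /g /= !mulf_eq0 !negb_or.
  by move=> /andP[/eqP h1 _] /andP[/eqP h2 /eqP h3] [].
exists H; split.
  move=> a b c' d ab cd sumV.
  have [x Hx xh] := Hhits (fun k => if k is k'.+1 then c' k' else a,
                        fun k => if k is k'.+1 then d k' else b).
  by exists x => //; apply: xh.
move=> x y z Hx Hy Hz /eqP xy /eqP xz /eqP yz; apply/eqP => h.
by apply: (Hbad x y z) => //; constructor 1.
Qed.

Lemma nneseries_pair (R : realType) : exists e : nat -> nat * nat,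
  (forall p, exists k, e k = p) /\
  forall f : nat * nat -> \bar R, (forall p, 0 <= f p)%E ->
    (\sum_(k <oo) f (e k) = \sum_(i <oo) \sum_(j <oo) f (i, j))%E.
Proof.
have /ppcard_eqP[e] : ([set: nat] #= [set: nat * nat])%card.
  by rewrite card_eq_sym card_nat2.
exists e; split=> [p|f f0].
  by have [k _ <-] := @surj _ _ _ _ e p I; exists k.
rewrite nneseries_esumT; last by move=> k; exact: f0.
rewrite -(@reindex_esum R _ _ setT setT e f); last exact: bij.
transitivity (\esum_(i in [set: nat]) \esum_(j in [set: nat]) f (i, j))%E.
  rewrite (@esum_esum R _ _ setT (fun=> setT) (fun i j => f (i, j))); last by move=> *; exact: f0.
  rewrite (_ : [set: nat] `*`` _ = setT); last by apply/seteqP; split.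
  by apply: eq_esum => -[].
rewrite nneseries_esumT; last by move=> i; apply: nneseries_ge0.
by apply: eq_esum => i _; rewrite nneseries_esumT.
Qed.

(** The [m]-th sequence is chosen with total weight at most [e / 2 ^ m.+1]. The weight is abstract
    so that the argument serves both box covers and Hausdorff covers. *)
Lemma merge_sequences (R : realType) (W : Type) (wt : W -> \bar R)
    (P : nat -> (nat -> W) -> Prop) :
  (forall m p, P m p -> forall k, 0 <= wt (p k))%E ->
  (forall m (e : R), 0 < e -> exists p, P m p /\ (\sum_(k <oo) wt (p k) <= e%:E)%E) ->
  forall e : R, 0 < e -> exists (q : nat -> W) (p : nat -> nat -> W), [/\
    forall m, P m (p m), forall m j, exists k, q k = p m j,
    forall k, exists m j, q k = p m j &
    (\sum_(k <oo) wt (q k) <= e%:E)%E].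
Proof.
move=> wt0 ex e e0.
have /choice[p pP] m : exists p, P m p /\
    (\sum_(k <oo) wt (p k) <= (e / (2 ^ m.+1)%:R)%:E)%E.
  by apply: ex; rewrite divr_gt0// ltr0n expn_gt0.
have [h [hsurj hsum]] := nneseries_pair R.
exists (fun k => p (h k).1 (h k).2), p; split.
- by move=> m; apply: (pP m).1.
- by move=> m j; have [k hk] := hsurj (m, j); exists k; rewrite hk.
- by move=> k; exists (h k).1, (h k).2.
rewrite (hsum (fun ij => wt (p ij.1 ij.2))); last first.
  by move=> [i j]; apply: wt0 (pP i).1 _.
have := @epsilon_trick R (fun=> 0%E) e xpredT (fun=> lexx _) (ltW e0).
rewrite [X in (_ <= X + _)%E]eseries0// add0e; apply: le_trans; apply: lee_nneseries => m _ /=.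
  by move=> _; apply: nneseries_ge0 => j _ _; apply: wt0 (pP m).1 _.
by rewrite add0e; apply: (pP m).2.
Qed.

Section Outer.
Context {R : realType} {n : nat}.
Hypothesis n_gt0 : (0 < n)%N.
Implicit Types (A H : set 'rV[R]_n).

Lemma box_volume_ge0 (a b : 'rV[R]_n) : (forall i, a 0 i <= b 0 i) -> 0 <= box_volume a b.
Proof. by move=> ab; apply: prodr_ge0 => i _; rewrite subr_ge0. Qed.

Lemma lebesgue_outer_ge0 A : (0 <= lebesgue_outer A)%E.
Proof.
apply/ereal_infP => _ [[a b] [/= ab _] <-]; apply: nneseries_ge0 => k _ _.
by rewrite lee_fin box_volume_ge0.
Qed.

Lemma lebesgue_outer_box (a b : 'rV[R]_n) : (forall i, a 0 i <= b 0 i) ->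
  (lebesgue_outer (box a b) <= (box_volume a b)%:E)%E.
Proof.
move=> ab; apply: ereal_inf_le.
exists (\sum_(k <oo) (box_volume (if k == 0%N then a else 0) (if k == 0%N then b else 0))%:E)%E.
  exists (fun k => if k == 0%N then a else 0, fun k => if k == 0%N then b else 0) => //.
  by split=> [[|k] i //|x xab]; exists 0%N.
rewrite (nneseries_split _ 1); last first.
  by move=> [|k] _; rewrite lee_fin ?box_volume_id// box_volume_ge0.
rewrite big_nat1 eseries0 ?adde0// => -[//|k] _ _.
by rewrite box_volume_id.
Qed.

Let cube m : set 'rV[R]_n := box (const_mx (- m.+1%:R)) (const_mx m.+1%:R).

Let cube_cover x : exists m, cube m x.
Proof.
exists (Num.bound (\sum_i `|x 0 i|)) => i; rewrite !mxE.
have xi : `|x 0 i| <= \sum_i `|x 0 i|.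
  by rewrite (bigD1 i)//= lerDl sumr_ge0.
have := archi_boundP (le_trans (normr_ge0 _) xi).
set N := Num.bound _ => hN.
have : `|x 0 i| < N.+1%:R by apply: le_lt_trans xi (lt_trans hN _); rewrite ltr_nat.
by rewrite ltr_norml => /andP[-> /ltW ->].
Qed.

(** Countable subadditivity over an exhaustion by cubes: covers of the null pieces merge into a
    cover of [A] of arbitrarily small volume. *)
Lemma lebesgue_outer_local A : (0 < lebesgue_outer A)%E ->
  exists m, (0 < lebesgue_outer (cube m `&` A))%E.
Proof.
move=> A0; apply: contrapT => nex.
have cA0 m : lebesgue_outer (cube m `&` A) = 0%E.
  apply/eqP; rewrite eq_le lebesgue_outer_ge0 andbT leNgt; apply/negP => h.
  by apply: nex; exists m.
move: A0; apply/negP; rewrite -leNgt; apply/lee_addgt0Pr => e e0; rewrite add0e.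
have [|m e' e'0|q [p [pP pq qp qe]]] := @merge_sequences R ('rV[R]_n * 'rV[R]_n)
    (fun ab => (box_volume ab.1 ab.2)%:E)
    (fun m p => (forall k i, (p k).1 0 i <= (p k).2 0 i) /\
      cube m `&` A `<=` \bigcup_k box (p k).1 (p k).2) _ _ e e0.
- by move=> m p [pP _] k; rewrite lee_fin box_volume_ge0.
- have /ereal_inf_lt[_ [[a b] [/= ab Aab] <-] sume] :
      (lebesgue_outer (cube m `&` A) < e'%:E)%E by rewrite cA0 lte_fin.
  by exists (fun k => (a k, b k)); split => //; apply: ltW.
apply: le_trans qe; apply: ereal_inf_lbound.
exists (fun k => (q k).1, fun k => (q k).2) => //; split=> /= [k i|x Ax].
  by have [m [j ->]] := qp k; apply: (pP m).1.
have [m mx] := cube_cover x.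
have [j _ jx] := (pP m).2 x (conj mx Ax).
by have [k qk] := pq m j; exists k => //; rewrite qk.
Qed.

(** Splitting a cube by the measurable [A], all terms being finite, leaves the complement of [A] in
    it with outer measure below the volume of the cube. Some cover of that complement is then too
    small to contain all of [H] in the cube, so [H] meets [A]. *)
Lemma meets_large_boxes_full H : meets_large_boxes H -> full_outer_measure H.
Proof.
move=> Hmeets [A [mA AH /lebesgue_outer_local[m m0]]].
pose a : 'rV[R]_n := const_mx (- m.+1%:R); pose b : 'rV[R]_n := const_mx m.+1%:R.
have ab i : a 0 i < b 0 i.
  by rewrite !mxE -subr_gt0 opprK -natrD ltr0n.
have : (lebesgue_outer (cube m `&` ~` A) < (box_volume a b)%:E)%E.
  have := lebesgue_outer_box (fun i => ltW (ab i)).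
  rewrite -/(cube m) mA => le.
  have fin : lebesgue_outer (cube m `&` ~` A) \is a fin_num.
    rewrite ge0_fin_numE ?lebesgue_outer_ge0//; apply: le_lt_trans (ltry (box_volume a b)).
    by apply: le_trans le; rewrite leeDr// lebesgue_outer_ge0.
  by apply: lt_le_trans le; rewrite lteDr.
move=> /ereal_inf_lt[_ [[c d] [/= cd cover] <-] sumV].
have [x Hx [xab xcd]] := Hmeets a b c d ab cd sumV.
have [|k _ xk] := cover x; last exact: (xcd k).
by split=> // /AH.
Qed.

End Outer.

(** * Hausdorff dimension *)

Section Hausdorff_dimension.
Context {R : realType} {n : nat}.
Hypothesis n_gt0 : (0 < n)%N.
Implicit Types (U A H : set 'rV[R]_n).

Lemma enorm_ge0 (u : 'rV[R]_n) : 0 <= enorm u.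
Proof. exact: sqrtr_ge0. Qed.

Lemma ler_coord_enorm (u : 'rV[R]_n) i : `|u 0 i| <= enorm u.
Proof.
rewrite -sqrtr_sqr; apply: ler_wsqrtr; rewrite /dotv (bigD1 i)//= expr2 lerDl.
by apply: sumr_ge0 => j _; rewrite -expr2 sqr_ge0.
Qed.

Lemma enorm_le (u : 'rV[R]_n) (h : R) :
  0 <= h -> (forall i, `|u 0 i| <= h) -> enorm u <= n%:R * h.
Proof.
move=> h0 uh; have nh : 0 <= n%:R * h by rewrite mulr_ge0.
rewrite -(ger0_norm nh) -sqrtr_sqr; apply: ler_wsqrtr.
apply: (@le_trans _ _ (\sum_(i < n) h ^+ 2)).
  apply: ler_sum => i _; rewrite -expr2 -real_normK ?num_real//.
  by rewrite ler_pXn2r// nnegrE.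
rewrite sumr_const card_ord -[X in X <= _]mulr_natl exprMn ler_wpM2r ?sqr_ge0//.
by rewrite expr2 ler_peMr// ler1n.
Qed.

Lemma le_diam U x y : U x -> U y -> ((enorm (x - y))%:E <= diam U)%E.
Proof. by move=> Ux Uy; apply: ereal_sup_ubound; exists (x, y). Qed.

Lemma diam_ge0 U : U !=set0 -> (0 <= diam U)%E.
Proof.
by move=> [x Ux]; apply: le_trans (le_diam Ux Ux); rewrite lee_fin enorm_ge0.
Qed.

Lemma diam_pow_ge0 (s : R) U : (0 <= diam_pow s U)%E.
Proof. by rewrite /diam_pow; case: ifP => // _; apply: poweR_ge0. Qed.

Lemma diam_pow_le (s r : R) U : 0 <= s -> (diam U <= r%:E)%E ->
  (diam_pow s U <= (r `^ s)%:E)%E.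
Proof.
move=> s0 Ur; rewrite /diam_pow; case: ifPn => [_|/set0P/diam_ge0 U0].
  by rewrite lee_fin powR_ge0.
rewrite -poweR_EFin; apply: gt0_ler_poweR => //; rewrite in_itv/= ?U0 ?leey//.
by rewrite (le_trans U0 Ur).
Qed.

(* A set of diameter [d <= 1] fits into a cube of volume at most [(4 d)^n],
   up to an arbitrarily small error that takes care of [d = 0]. *)
Lemma box_around (s e : R) U : 0 <= s -> s <= n%:R -> 0 < e -> e <= 1 ->
  (diam U <= 1)%E -> exists a b : 'rV[R]_n, [/\ forall i, a 0 i <= b 0 i,
    U `<=` box a b & ((box_volume a b)%:E <= (4 ^+ n)%:E * diam_pow s U + e%:E)%E].
Proof.
move=> s0 sn e0 e1 U1.
have [->|/set0P Un0] := eqVneq U set0.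
  exists 0, 0; split=> //.
  rewrite box_volume_id//; apply: adde_ge0; last by rewrite lee_fin ltW.
  by rewrite mule_ge0 ?diam_pow_ge0// lee_fin exprn_ge0.
have Ufin : diam U \is a fin_num.
  by rewrite ge0_fin_numE ?diam_ge0//; apply: le_lt_trans U1 (ltry 1).
have [d dU] : exists d, diam U = d%:E by exists (fine (diam U)); rewrite fineK.
have d0 : 0 <= d by rewrite -lee_fin -dU diam_ge0.
have d1 : d <= 1 by rewrite -lee_fin -dU.
have [u Uu] := Un0.
(* Half-side [2 * d] gives volume [(4 * d) ^+ n]; half-side [e / 2] gives [e ^+ n <= e] and keeps
   the half-open box nonempty when [d = 0]. *)
pose r := Num.max (2 * d) (e / 2).
have rd : 2 * d <= r by rewrite le_max lexx.
have re : e / 2 <= r by rewrite le_max lexx orbT.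
exists (\row_i (u 0 i - r)), (\row_i (u 0 i + r)); split.
- by move=> i; rewrite !mxE; lra.
- move=> x Ux i; rewrite !mxE.
  have : `|(x - u) 0 i| <= d.
    by rewrite (le_trans (ler_coord_enorm _ _))// -lee_fin -dU le_diam.
  rewrite !mxE ler_norml => /andP[h1 h2]; apply/andP; split; lra.
have -> : box_volume (\row_i (u 0 i - r)) (\row_i (u 0 i + r)) = (2 * r) ^+ n.
  rewrite -[n in RHS]card_ord -prodr_const; apply: eq_bigr => i _.
  by rewrite !mxE; ring.
have -> : diam_pow s U = (d `^ s)%:E.
  by rewrite /diam_pow dU; case: ifPn => [/eqP U0|//]; move: Uu; rewrite U0.
rewrite -EFinM -EFinD lee_fin.
have dn : d ^+ n <= d `^ s.
  rewrite -powR_mulrn//; move: d0; rewrite le_eqVlt => /orP[/eqP <-|d0].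
    by rewrite powR_mulrn// expr0n gtn_eqF//= powR_ge0.
  by apply: ger_powR => //; rewrite d0.
have /orP[/eqP ->|/eqP ->] : (r == 2 * d) || (r == e / 2).
  by rewrite /r; case: leP => _; rewrite eqxx ?orbT.
- rewrite mulrA -natrM exprMn -[X in X <= _]addr0 lerD//; last exact: ltW.
  by rewrite ler_wpM2l// exprn_ge0.
- rewrite mulrC divfK// -[X in X <= _]add0r lerD//.
    by rewrite mulr_ge0 ?exprn_ge0 ?powR_ge0.
  by rewrite -[X in _ <= X]expr1 ler_wiXn2l// ?ltW// .
Qed.

Lemma meets_large_boxes_hausdorff (s : R) H : meets_large_boxes H ->
  0 <= s -> hausdorff_measure s H = 0%E -> n%:R <= s.
Proof.
move=> Hmeets s0 H0; rewrite leNgt; apply/negP => sn.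
have pre0 : (hausdorff_pre s 1 H <= 0)%E.
  by rewrite -H0; apply: ereal_sup_ubound; exists 1 => /=.
have pos4 : 0 < 4 ^+ n :> R by rewrite exprn_gt0.
(* This threshold bounds the main terms of the box volumes by [1/2] in total; the errors [e k] add
   at most [1/4], which stays below the volume 1 of the unit cube. *)
have /ereal_inf_lt[_ [U [U1 HU] <-] sumU] : (hausdorff_pre s 1 H < (2^-1 / 4 ^+ n)%:E)%E.
  by apply: le_lt_trans pre0 _; rewrite lte_fin divr_gt0.
pose e k : R := 4^-1 / (2 ^ k.+1)%:R.
have e0 k : 0 < e k by rewrite divr_gt0// ltr0n expn_gt0.
have e1 k : e k <= 1.
  rewrite ler_pdivrMr ?ltr0n ?expn_gt0// mul1r (@le_trans _ _ 1)//; first lra.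
  by rewrite ler1n expn_gt0.
have /choice[a /choice[b abP]] k := box_around s0 (ltW sn) (e0 k) (e1 k) (U1 k).
have [|||x Hx [_ xk]] := Hmeets 0 (const_mx 1) a b.
- by move=> i; rewrite !mxE.
- by move=> k; have [] := abP k.
- rewrite [X in (_ < X%:E)%E](_ : _ = 1); last first.
    by apply: big1 => i _; rewrite !mxE subr0.
  apply: (@le_lt_trans _ _ (\sum_(k <oo) ((4 ^+ n)%:E * diam_pow s (U k) + (e k)%:E))%E).
    apply: lee_nneseries => k _; have [ab _ vol] := abP k => //.
    by rewrite lee_fin box_volume_ge0.
  have t0 k : (0 <= (4 ^+ n)%:E * diam_pow s (U k))%E.
    by rewrite mule_ge0 ?diam_pow_ge0// lee_fin ltW.
  have q0 : 0 <= 4^-1 :> R by lra.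
  apply: le_lt_trans (epsilon_trick xpredT t0 q0) _.
  rewrite nneseriesZl; last by move=> k _; apply: diam_pow_ge0.
  have lt2 : ((4 ^+ n)%:E * \sum_(k <oo) diam_pow s (U k) <= 2^-1%:E)%E.
    by rewrite -lee_pdivlMl// -EFinM mulrC ltW.
  apply: le_lt_trans (leeD2r _ lt2) _.
  by rewrite -EFinD lte_fin; lra.
- have [k _ Ukx] := HU x Hx; apply: (xk k).
  by have [_ + _] := abP k; apply.
Qed.

Lemma diam0 : diam (@set0 'rV[R]_n) = -oo%E.
Proof.
rewrite /diam (_ : [set _ | _ in _] = set0) ?ereal_sup0//.
by rewrite -subset0 => y [p []].
Qed.

(** Cutting the cube into [N.+1 ^ n] cells of diameter at most [L / N.+1] costs at most
    [L^s * N.+1^(n - s)], which tends to zero because [s] exceeds [n]. *)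
Lemma fine_cover_cube (s delta e : R) (m : nat) :
  n%:R < s -> 0 < delta -> 0 < e -> exists U : nat -> set 'rV[R]_n, [/\
    forall k, (diam (U k) <= delta%:E)%E,
    [set x : 'rV[R]_n | forall i, `|x 0 i| < m.+1%:R] `<=` \bigcup_k U k &
    (\sum_(k <oo) diam_pow s (U k) <= e%:E)%E].
Proof.
move=> ns delta0 e0.
pose M : R := m.+1%:R; pose L := n%:R * (2 * M).
have n0R : 0 < n%:R :> R by rewrite ltr0n.
have M0 : 0 < M by rewrite ltr0n.
have L0 : 0 < L by rewrite !mulr_gt0.
have p0 : 0 < s - n%:R by rewrite subr_gt0.
have s0 : 0 < s by apply: lt_trans ns.
(* From [X] on, the [(s - n)]-th power of [N.+1] is at least [L^s / e]. *)
pose X := (L `^ s / e) `^ (s - n%:R)^-1.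
have Ls : 0 < L `^ s by rewrite powR_gt0.
have [N LN XN] : exists2 N, L / delta <= N.+1%:R & X <= N.+1%:R.
  pose Y := Num.max (L / delta) X.
  have Y0 : 0 <= Y by rewrite le_max powR_ge0 orbT.
  have YN : Y <= (Num.bound Y).+1%:R.
    by apply: ltW; apply: lt_trans (archi_boundP Y0) _; rewrite ltr_nat.
  by exists (Num.bound Y); apply: le_trans YN; rewrite le_max lexx ?orbT.
have N0 : 0 < N.+1%:R :> R by rewrite ltr0n.
pose h := 2 * M / N.+1%:R.
have h0 : 0 < h by rewrite divr_gt0// mulr_gt0.
have nhE : n%:R * h = L / N.+1%:R by rewrite /L /h mulrA.
have nh_delta : n%:R * h <= delta.
  by rewrite nhE ler_pdivrMr// [delta * _]mulrC -ler_pdivrMr//.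
have total : (n%:R * h) `^ s *+ N.+1 ^ n <= e.
  have KE : (n%:R * h) `^ s * N.+1%:R ^+ n * N.+1%:R `^ (s - n%:R) = L `^ s.
    rewrite -mulrA -powR_mulrn ?ltW// -powRD; last by rewrite (gt_eqF N0) implybT.
    by rewrite subrKC -powRM ?mulr_ge0 ?ltW// nhE divfK// gt_eqF.
  have NX : L `^ s / e <= N.+1%:R `^ (s - n%:R).
    have -> : L `^ s / e = X `^ (s - n%:R).
      by rewrite /X -powRrM mulVf ?gt_eqF// powRr1// divr_ge0 ?ltW.
    by apply: ge0_ler_powR; rewrite ?nnegrE ?powR_ge0// ?ltW.
  have Np : 0 < N.+1%:R `^ (s - n%:R) :> R by rewrite powR_gt0.
  rewrite -mulr_natr natrX -(ler_pM2r Np) KE [e * _]mulrC -ler_pdivrMr//.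
pose F := {ffun 'I_n -> 'I_N.+1}.
pose cell (v : F) : set 'rV[R]_n :=
  [set x | forall i, - M + (v i)%:R * h <= x 0 i <= - M + (v i).+1%:R * h].
(* The cells are numbered first; all later sets are empty and contribute 0 to the sum. *)
pose U k := if (insub k : option 'I_#|F|) is Some i then cell (enum_val i) else set0.
have Udiam k : (diam (U k) <= (n%:R * h)%:E)%E.
  rewrite /U; case: insub => [j|]; last by rewrite diam0 leNye.
  apply: ge_ereal_sup => _ [[x y] [/= xj yj] <-]; rewrite lee_fin.
  apply: enorm_le; first exact: ltW.
  move=> i; have := xj i; have := yj i; rewrite !mxE -natr1 mulrDl mul1r.
  by move: (_ * h) => z; rewrite ler_norml; lra.
exists U; split.
- by move=> k; apply: le_trans (Udiam k) _; rewrite lee_fin.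
- move=> x xM.
  have y0 i : 0 <= (x 0 i + M) / h.
    by rewrite divr_ge0 ?ltW//; have := xM i; rewrite ltr_norml -/M; lra.
  have yN (i : 'I_n) : (Num.truncn ((x 0 i + M) / h)%R < N.+1)%N.
    rewrite truncn_lt_nat// ltr_pdivrMr// /h mulrC divfK ?gt_eqF//.
    by have := xM i; rewrite ltr_norml -/M; lra.
  pose v : F := [ffun i => Ordinal (yN i)].
  exists (enum_rank v : nat) => //.
  rewrite /U valK enum_rankK => i; rewrite ffunE /=.
  have := truncn_itv (y0 i); rewrite ler_pdivlMr// ltr_pdivrMr//.
  by move: (_%:R * h) (_%:R * h) => z z'; lra.
- rewrite (nneseries_split _ #|F|); last by move=> k _; apply: diam_pow_ge0.
  rewrite eseries0 ?adde0; last first.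
    move=> k kF _; rewrite /U insubF; first by rewrite /diam_pow eqxx.
    by apply/negbTE; rewrite -leqNgt.
  apply: (@le_trans _ _ (\sum_(0 <= k < 0 + #|F|) ((n%:R * h) `^ s)%:E)%E).
    by apply: lee_sum => k _; apply: diam_pow_le => //; apply: ltW.
  rewrite sumEFin lee_fin add0n sumr_const_nat subn0 card_ffun !card_ord.
  exact: total.
Qed.

Lemma hausdorff_measure_eq0 (s : R) A : n%:R < s -> hausdorff_measure s A = 0%E.
Proof.
move=> ns; apply/eqP; rewrite eq_le; apply/andP; split; last first.
  apply: le_trans (_ : hausdorff_pre s 1 A <= _)%E.
    apply/ereal_infP => _ [U _ <-]; apply: nneseries_ge0 => k _ _.
    exact: diam_pow_ge0.
  by apply: ereal_sup_ubound; exists 1 => /=.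
apply: ge_ereal_sup => _ [delta /= delta0 <-].
apply/lee_addgt0Pr => e e0; rewrite add0e.
have [|m e' e'0|q [p [pP pq qp qe]]] := @merge_sequences R (set 'rV[R]_n)
    (diam_pow s)
    (fun m (U : nat -> set 'rV[R]_n) => (forall k, (diam (U k) <= delta%:E)%E) /\
      [set x : 'rV[R]_n | forall i, `|x 0 i| < m.+1%:R] `<=` \bigcup_k U k) _ _ e e0.
- by move=> m p _ k; apply: diam_pow_ge0.
- by have [U [U1 U2 U3]] := fine_cover_cube m ns delta0 e'0; exists U.
apply: le_trans qe; apply: ereal_inf_lbound; exists q => //; split.
  by move=> k; have [m [j ->]] := qp k; apply: (pP m).1.
move=> x _; have [m mx] : exists m : nat, forall i, `|x 0 i| < m.+1%:R.
  exists (Num.bound (enorm x)) => i; apply: le_lt_trans (ler_coord_enorm x i) _.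
  by apply: lt_trans (archi_boundP (enorm_ge0 x)) _; rewrite ltr_nat.
have [j _ jx] := (pP m).2 x mx.
by have [k qk] := pq m j; exists k => //; rewrite qk.
Qed.

Lemma meets_large_boxes_dim H : meets_large_boxes H -> hausdorff_dim H = n%:R%:E.
Proof.
move=> Hmeets; apply/eqP; rewrite eq_le; apply/andP; split.
  apply/lee_addgt0Pr => e e0; apply: ereal_inf_lbound; exists (n%:R + e) => //=.
  by split; [rewrite addr_ge0// ltW|apply: hausdorff_measure_eq0; rewrite ltrDl].
apply/ereal_infP => _ [s /= [s0 Hs] <-]; rewrite lee_fin.
exact: meets_large_boxes_hausdorff Hs.
Qed.

End Hausdorff_dimension.

Theorem theorem5p1 (R : realType) (n : nat) (n_ge2 : (2 <= n)%N)
    (alpha : R) (alpha_ge0 : 0 <= alpha) (alpha_lepi : alpha <= pi) :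
  exists H : set 'rV[R]_n,
    [/\ ~ contains_angle H alpha,
        full_outer_measure H
      & hausdorff_dim H = n%:R%:E].
Proof.
have n_gt0 : (0 < n)%N by apply: ltnW.
have [H [Hmeets Hfree]] := angle_form_free_set (cos alpha) n_ge2.
exists H; split.
- move=> [x [y [z [[Hx Hy Hz] [[xy xz yz] xyz]]]]].
  have := Hfree x y z Hx Hy Hz xy xz yz.
  by rewrite -xyz angle_form_eq0 ?eqxx.
- exact: meets_large_boxes_full.
- exact: meets_large_boxes_dim.
Qed.
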